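(* There is an algorithm that, given a finite simple graph $G$, decides in time linear in the size of $G$ (i.e., $O(|V(G)|+|E(G)|)$) whether $G$ is a proper $2$-color-line graph, and, if so, constructs within the same linear time bound a graph $H$ with a proper edge $2$-coloring such that $G\cong\mathrm{CL}(H)$.
   Context: An edge $2$-coloring $\phi:E(H)\to\{1,2\}$ is proper if any two distinct edges sharing an endvertex get different colors. For an edge-colored graph $(H,\phi)$, the color-line graph $\mathrm{CL}(H)$ has vertex set $E(H)$, two distinct vertices being adjacent iff the corresponding edges of $H$ share an endvertex or have the same color. $G$ is a proper $2$-color-line graph if $G\cong\mathrm{CL}(H)$ for some graph $H$ with a proper edge $2$-coloring. *)

(* Defs.v *)
From HB Require Import structures.
From mathcomp Require Import all_boot.

Set Implicit Arguments.
Unset Strict Implicit.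
Unset Printing Implicit Defensive.

Record sgraph := SGraph {
  vertex :> finType;
  adj : rel vertex;
  adj_sym : symmetric adj;
  adj_irr : irreflexive adj }.

Definition edges (G : sgraph) : {set {set G}} :=
  [set E : {set G} | [exists x, exists y, adj x y && (E == [set x; y])]].

Definition edge (G : sgraph) : finType := {E : {set G} | E \in edges G}.

Definition giso (G1 G2 : sgraph) : Prop :=
  exists2 f : G1 -> G2, bijective f & forall x y, adj (f x) (f y) = adj x y.

Definition share_end (H : sgraph) (E F : edge H) : bool :=
  val E :&: val F != set0.

(* The two colors 1, 2 are the ordinals 0, 1 of 'I_2. *)
Definition proper_coloring (H : sgraph) (phi : edge H -> 'I_2) : Prop :=
  forall E F : edge H, E != F -> share_end E F -> phi E != phi F.

Definition CL_adj (H : sgraph) (phi : edge H -> 'I_2) : rel (edge H) :=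
  fun E F => (E != F) && (share_end E F || (phi E == phi F)).

Lemma CL_sym (H : sgraph) (phi : edge H -> 'I_2) : symmetric (CL_adj phi).
Proof.
by move=> E F; rewrite /CL_adj /share_end setIC eq_sym [phi E == _]eq_sym.
Qed.

Lemma CL_irr (H : sgraph) (phi : edge H -> 'I_2) : irreflexive (CL_adj phi).
Proof. by move=> E; rewrite /CL_adj eqxx. Qed.

Definition CL (H : sgraph) (phi : edge H -> 'I_2) : sgraph :=
  SGraph (CL_sym phi) (CL_irr phi).

Definition proper_2_color_line (G : sgraph) : Prop :=
  exists (H : sgraph) (phi : edge H -> 'I_2),
    proper_coloring phi /\ giso G (CL phi).

(* Model of computation: a unit-cost word RAM, presented as a while-language
   over finitely many scalar registers and arrays of naturals (both named by
   numerals; a program is a finite term, so it mentions finitely many of them).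
   Every operator of an expression and every command step costs 1.  No computed
   or fetched value, in particular no array index, may exceed the largest word
   [W]: otherwise evaluation is undefined and the program has no execution.  With
   [W] linear in the size of the input, words have log(size) + O(1) bits. *)
Inductive expr :=
  | Const of nat
  | Var of nat
  | Get of nat & expr
  | Add of expr & expr
  | Sub of expr & expr
  | Mul of expr & expr
  | Leq of expr & expr
  | Eqn of expr & expr.

Inductive cmd :=
  | Skip
  | Assign of nat & expr
  | Put of nat & expr & expr
  | Seq of cmd & cmd
  | If of expr & cmd & cmd
  | While of expr & cmd.

Record state := State { var : nat -> nat; arr : nat -> nat -> nat }.

Definition set_var (s : state) (x v : nat) : state :=
  State (fun y => if y == x then v else var s y) (arr s).

Definition set_arr (s : state) (a i v : nat) : state :=
  State (var s)
    (fun b j => if (b == a) && (j == i) then v else arr s b j).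

Definition word (W v : nat) : option nat := if v <= W then Some v else None.

Definition word2 (W : nat) (op : nat -> nat -> nat) (u v : option nat) :
    option nat :=
  if (u, v) is (Some x, Some y) then word W (op x y) else None.

Fixpoint eval (W : nat) (s : state) (e : expr) : option nat :=
  match e with
  | Const n => word W n
  | Var x => word W (var s x)
  | Get a e1 => if eval W s e1 is Some i then word W (arr s a i) else None
  | Add e1 e2 => word2 W addn (eval W s e1) (eval W s e2)
  | Sub e1 e2 => word2 W subn (eval W s e1) (eval W s e2)
  | Mul e1 e2 => word2 W muln (eval W s e1) (eval W s e2)
  | Leq e1 e2 => word2 W (fun x y => x <= y : nat) (eval W s e1) (eval W s e2)
  | Eqn e1 e2 => word2 W (fun x y => x == y : nat) (eval W s e1) (eval W s e2)
  end.

Fixpoint ecost (e : expr) : nat :=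
  match e with
  | Const _ | Var _ => 1
  | Get _ e1 => (ecost e1).+1
  | Add e1 e2 | Sub e1 e2 | Mul e1 e2 | Leq e1 e2 | Eqn e1 e2 =>
      (ecost e1 + ecost e2).+1
  end.

(* [exec W p s t s']: started in [s], the program [p] halts in [s'] after [t]
   steps.  This relation is deterministic, see [exec_det]. *)
Inductive exec (W : nat) : cmd -> state -> nat -> state -> Prop :=
  | ExecSkip s : exec W Skip s 1 s
  | ExecAssign s x e v : eval W s e = Some v ->
      exec W (Assign x e) s (ecost e).+1 (set_var s x v)
  | ExecPut s a e1 e2 i v : eval W s e1 = Some i -> eval W s e2 = Some v ->
      exec W (Put a e1 e2) s (ecost e1 + ecost e2).+1 (set_arr s a i v)
  | ExecSeq p q s1 s2 s3 t1 t2 : exec W p s1 t1 s2 -> exec W q s2 t2 s3 ->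
      exec W (Seq p q) s1 (t1 + t2) s3
  | ExecIfTrue e p q s s' t v : eval W s e = Some v -> v != 0 ->
      exec W p s t s' -> exec W (If e p q) s ((ecost e).+1 + t) s'
  | ExecIfFalse e p q s s' t : eval W s e = Some 0 ->
      exec W q s t s' -> exec W (If e p q) s ((ecost e).+1 + t) s'
  | ExecWhileTrue e p s1 s2 s3 t1 t2 v : eval W s1 e = Some v -> v != 0 ->
      exec W p s1 t1 s2 -> exec W (While e p) s2 t2 s3 ->
      exec W (While e p) s1 ((ecost e).+1 + t1 + t2) s3
  | ExecWhileFalse e p s : eval W s e = Some 0 ->
      exec W (While e p) s (ecost e).+1 s.

Lemma exec_det (W : nat) (p : cmd) (s : state) (t1 t2 : nat) (s1 s2 : state) :
  exec W p s t1 s1 -> exec W p s t2 s2 -> t1 = t2 /\ s1 = s2.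
Proof.
move=> E1; elim: E1 t2 s2 => {p s t1 s1}.
- by move=> s t2 s2 E; inversion E.
- by move=> s x e v Hv t2 s2 E; inversion E; subst; split=> //; congruence.
- move=> s a e1 e2 i v Hi Hv t2 s2 E; inversion E; subst.
  by split=> //; congruence.
- move=> p q s1 s2 s3 t1 t2 _ IH1 _ IH2 t s E; inversion E as
    [| | |? ? ? ? ? ? ? E1 E2| | | |]; subst.
  have [? ?] := IH1 _ _ E1; subst.
  by have [? ?] := IH2 _ _ E2; subst.
- move=> e p q s s' t v Hv v0 _ IH t2 s2 E; inversion E as
    [| | | |? ? ? ? ? ? ? _ _ E1|? ? ? ? ? ? Hv0| |]; subst.
    by have [-> ->] := IH _ _ E1.
  by move: v0; have -> : v = 0 by congruence.
- move=> e p q s s' t Hv _ IH t2 s2 E; inversion E as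
    [| | | |? ? ? ? ? ? v' Hv' v0|? ? ? ? ? ? _ E1| |]; subst.
    by move: v0; have -> : v' = 0 by congruence.
  by have [-> ->] := IH _ _ E1.
- move=> e p s1 s2 s3 t1 t2 v Hv v0 _ IH1 _ IH2 t s E; inversion E as
    [| | | | | |? ? ? ? ? ? ? ? _ _ E1 E2|? ? ? Hv0]; subst.
    have [? ?] := IH1 _ _ E1; subst.
    by have [-> ->] := IH2 _ _ E2.
  by move: v0; have -> : v = 0 by congruence.
- move=> e p s Hv t2 s2 E; inversion E as
    [| | | | | |? ? ? ? ? ? ? v' Hv' v0|]; subst => //.
  by move: v0; have -> : v' = 0 by congruence.
Qed.

(* An adjacency-list representation of G: an arbitrary numbering of the
   vertices (the position in [order]) and, for every vertex, the list of its
   neighbours in arbitrary order. *)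
Record adj_lists (G : sgraph) := AdjLists {
  order : seq G;
  order_uniq : uniq order;
  order_mem : forall x, x \in order;
  nbrs : G -> seq G;
  nbrs_uniq : forall x, uniq (nbrs x);
  nbrs_mem : forall x y, (y \in nbrs x) = adj x y }.

(* The neighbours of vertex number i are stored, as vertex numbers, in the
   cells [offset i, offset i.+1[ of the concatenation of all lists. *)
Definition offsets (G : sgraph) (A : adj_lists G) : seq nat :=
  let degs := [seq size (nbrs A x) | x <- order A] in
  [seq sumn (take i degs) | i <- iota 0 (size (order A)).+1].

Definition targets (G : sgraph) (A : adj_lists G) : seq nat :=
  flatten [seq [seq index y (order A) | y <- nbrs A x] | x <- order A].

Definition input_state (G : sgraph) (A : adj_lists G) : state :=
  State
    (fun x => if x == 0 then size (order A) else 0)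
    (fun a i => if a == 0 then nth 0 (offsets A) i
                else if a == 1 then nth 0 (targets A) i else 0).

Definition answer (s : state) : nat := var s 0.
Definition out_nv (s : state) : nat := var s 1.
Definition out_ne (s : state) : nat := var s 2.
Definition out_end1 (s : state) (i : nat) : nat := arr s 0 i.
Definition out_end2 (s : state) (i : nat) : nat := arr s 1 i.
Definition out_color (s : state) (i : nat) : nat := arr s 2 i.

(* The final state holds (H, phi) as a colored edge list: the number of
   vertices, the number of edges, and for every edge (each listed once) the
   numbers of its two ends and its color, 1 or 2. *)
Definition output_encodes (s : state) (H : sgraph) (phi : edge H -> 'I_2) :
    Prop :=
  exists (vx : 'I_(out_nv s) -> H) (ed : 'I_(out_ne s) -> edge H),
    [/\ bijective vx, bijective ed &
      forall i : 'I_(out_ne s),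
        out_color s i = (phi (ed i)).+1 /\
        exists a b : 'I_(out_nv s),
          [/\ out_end1 s i = a, out_end2 s i = b &
              val (ed i) = [set vx a; vx b]]].

Definition graph_size (G : sgraph) : nat := #|G| + #|edges G|.

(* Main.v *)
Require Import Defs.
From mathcomp Require Import all_boot zify.

(** G is a proper 2-color-line graph iff its vertices split into two cliques such
    that every vertex has at most two neighbors in the other clique.  Given such
    a split, H is read off locally: every edge of G between the cliques becomes a
    vertex of H, and the vertex x of G becomes the edge of H joining the (at most
    two) crossing edges at x, completed by pendant vertices.

    To find a split, note that of the first five vertices three lie in one
    clique A, and any further vertex is in A iff it is adjacent to at least three
    of the first five that are in A.  So the split is determined by its trace on
    the first five vertices; each of the 32 traces is tried, and the resulting
    partition is verified in linear time by counting, at every vertex, the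
    neighbors in either part. *)

Set Implicit Arguments.
Unset Strict Implicit.
Unset Printing Implicit Defensive.

(** * Running programs within a time budget *)

(** Values without overflow check. [safe] collects the bounds under which [eval] returns them, so
    that reasoning about programs is plain arithmetic instead of a calculus of options. *)
Fixpoint den (s : state) (e : expr) : nat :=
  match e with
  | Const n => n
  | Var x => var s x
  | Get a e1 => arr s a (den s e1)
  | Add e1 e2 => den s e1 + den s e2
  | Defs.Sub e1 e2 => den s e1 - den s e2
  | Mul e1 e2 => den s e1 * den s e2
  | Leq e1 e2 => den s e1 <= den s e2
  | Eqn e1 e2 => den s e1 == den s e2
  end.

Fixpoint safe (W : nat) (s : state) (e : expr) : bool :=
  match e with
  | Const n => n <= W
  | Var x => var s x <= W
  | Get a e1 => safe W s e1 && (arr s a (den s e1) <= W)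
  | Add e1 e2 => [&& safe W s e1, safe W s e2 & den s e1 + den s e2 <= W]
  | Mul e1 e2 => [&& safe W s e1, safe W s e2 & den s e1 * den s e2 <= W]
  | Defs.Sub e1 e2 => safe W s e1 && safe W s e2
  | Leq e1 e2 | Eqn e1 e2 => [&& safe W s e1, safe W s e2 & 0 < W]
  end.

Lemma safe_den_le W s e : safe W s e -> den s e <= W.
Proof.
elim: e => //= [a e _ /andP[] //|e1 _ e2 _ /and3P[] //|e1 IH1 e2 _|
  |e1 _ e2 _|e1 _ e2 _].
- by case/andP=> /IH1 le1 _; lia.
- by move=> e1 _ e2 _ /and3P[].
- by case/and3P=> _ _; lia.
- by case/and3P=> _ _; lia.
Qed.

Lemma safe_eval W s e : safe W s e -> eval W s e = Some (den s e).
Proof.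
elim: e => /=; rewrite /word.
- by move=> n ->.
- by move=> x ->.
- by move=> a e IH /andP[/IH -> ->].
- by move=> e1 IH1 e2 IH2 /and3P[/IH1 -> /IH2 ->]; rewrite /word2 /word => ->.
- move=> e1 IH1 e2 IH2 /andP[s1 s2]; rewrite (IH1 s1) (IH2 s2) /word2 /word.
  by rewrite (leq_trans (leq_subr _ _) (safe_den_le s1)).
- by move=> e1 IH1 e2 IH2 /and3P[/IH1 -> /IH2 ->]; rewrite /word2 /word => ->.
- move=> e1 IH1 e2 IH2 /and3P[/IH1 -> /IH2 -> W0]; rewrite /word2 /word.
  by rewrite (leq_trans (leq_b1 _) W0).
- move=> e1 IH1 e2 IH2 /and3P[/IH1 -> /IH2 -> W0]; rewrite /word2 /word.
  by rewrite (leq_trans (leq_b1 _) W0).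
Qed.

(** A Hoare triple of total correctness. [T] bounds the cost only from above, so budgets may be
    rounded up. *)
Definition runs W p s T (Q : state -> Prop) : Prop :=
  exists t s', [/\ exec W p s t s', t <= T & Q s'].

Lemma runs_weaken W p s T T' (Q Q' : state -> Prop) :
  runs W p s T Q -> T <= T' -> (forall s', Q s' -> Q' s') -> runs W p s T' Q'.
Proof.
move=> [t [s' [E le_t Qs']]] leT QQ'; exists t, s'; split=> //.
  exact: leq_trans leT.
exact: QQ'.
Qed.

Lemma runs_budget T W p s T' Q : T <= T' -> runs W p s T Q -> runs W p s T' Q.
Proof. by move=> leT /runs_weaken; apply. Qed.

Lemma runs_seq W p q s T1 T2 (Q1 Q : state -> Prop) :
  runs W p s T1 Q1 -> (forall s', Q1 s' -> runs W q s' T2 Q) ->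
  runs W (Seq p q) s (T1 + T2) Q.
Proof.
move=> [t1 [s1 [E1 le1 Q1s]]] /(_ _ Q1s) [t2 [s2 [E2 le2 Qs]]].
by exists (t1 + t2), s2; split=> //; [exact: ExecSeq E2|exact: leq_add].
Qed.

Lemma runs_if W e p q s T (Q : state -> Prop) :
  safe W s e -> (den s e <> 0 -> runs W p s T Q) ->
  (den s e = 0 -> runs W q s T Q) ->
  runs W (If e p q) s ((ecost e).+1 + T) Q.
Proof.
move=> /safe_eval Ee Hp Hq; case: (den s e =P 0) => [e0|/[dup] /eqP e1 /Hp].
  have [t [s' [E le_t Qs']]] := Hq e0.
  exists ((ecost e).+1 + t), s'; rewrite leq_add2l; split=> //.
  by apply: ExecIfFalse => //; rewrite Ee e0.
move=> [t [s' [E le_t Qs']]].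
exists ((ecost e).+1 + t), s'; rewrite leq_add2l; split=> //.
exact: ExecIfTrue Ee e1 E.
Qed.

(** Both branches of a conditional are charged. Since [wp] is [False] on loops, the bound is claimed
    for loop-free programs only. *)
Fixpoint loop_free_cost (p : cmd) : nat :=
  match p with
  | Skip | While _ _ => 1
  | Assign _ e => (ecost e).+1
  | Put _ e1 e2 => (ecost e1 + ecost e2).+1
  | Seq p q => loop_free_cost p + loop_free_cost q
  | If e p q => (ecost e).+1 + (loop_free_cost p + loop_free_cost q)
  end.

Fixpoint wp (W : nat) (p : cmd) (s : state) (Q : state -> Prop) : Prop :=
  match p with
  | Skip => Q s
  | Assign x e => safe W s e /\ Q (set_var s x (den s e))
  | Put a e1 e2 =>
      safe W s e1 && safe W s e2 /\ Q (set_arr s a (den s e1) (den s e2))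
  | Seq p q => wp W p s (fun s' => wp W q s' Q)
  | If e p q => safe W s e /\
      (den s e <> 0 -> wp W p s Q) /\ (den s e = 0 -> wp W q s Q)
  | While _ _ => False
  end.

Lemma runs_wp W p s Q : wp W p s Q -> runs W p s (loop_free_cost p) Q.
Proof.
elim: p s Q => //=.
- by move=> s Q Qs; exists 1, s; split=> //; constructor.
- move=> x e s Q [/safe_eval Ee Qs].
  by exists (ecost e).+1, (set_var s x (den s e)); split=> //; constructor.
- move=> a e1 e2 s Q [/andP[/safe_eval E1 /safe_eval E2] Qs].
  exists (ecost e1 + ecost e2).+1, (set_arr s a (den s e1) (den s e2)).
  by split=> //; constructor.
- by move=> p IHp q IHq s Q /IHp /runs_seq; apply=> s' /IHq.
- move=> e p IHp q IHq s Q [se [Hp Hq]]; apply: runs_if => // e0.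
    by apply: runs_weaken (IHp _ _ (Hp e0)) _ _ => //; rewrite leq_addr.
  by apply: runs_weaken (IHq _ _ (Hq e0)) _ _ => //; rewrite leq_addl.
Qed.

Lemma runs_wp_seq W p q s T Q :
  wp W p s (fun s' => runs W q s' T Q) ->
  runs W (Seq p q) s (loop_free_cost p + T) Q.
Proof. by move=> /runs_wp /runs_seq; apply. Qed.

(** The language has no strict comparison, so [x < hi] is tested as [x + 1 <= hi]. *)
Definition For (x : nat) (hi : expr) (body : cmd) : cmd :=
  While (Leq (Add (Var x) (Const 1)) hi)
        (Seq body (Assign x (Add (Var x) (Const 1)))).

(** Induction on the number of remaining rounds. A test of the guard costs [ecost hi + 5] and the
    increment 4; the term after the sum pays for the last, failing test. [N < W] keeps [x + 1] a
    word even at [x = N]. *)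
Lemma runs_for W x hi body (I : nat -> state -> Prop) (T : nat -> nat) lo N s :
  lo <= N -> N < W ->
  (forall k s, I k s -> [/\ var s x = k, safe W s hi & den s hi = N]) ->
  (forall k s, lo <= k < N -> I k s ->
     runs W body s (T k)
       (fun s' => var s' x = k /\ I k.+1 (set_var s' x k.+1))) ->
  I lo s ->
  runs W (For x hi body) s
    (\sum_(lo <= k < N) (T k + (ecost hi + 9)) + (ecost hi + 9)) (I N).
Proof.
move=> le_loN ltNW Ihi Ibody; move: {-2}(N - lo) (erefl (N - lo)) => m.
elim: m lo s le_loN Ibody => [|m IHm] lo s le_loN Ibody def_m Is.
  have def_lo : lo = N by lia.
  move: Is; rewrite def_lo => Is; have [xk shi dhi] := Ihi _ _ Is.
  rewrite big_geq // add0n; exists (ecost hi + 5), s; split=> //; last lia.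
  have -> : ecost hi + 5 = (ecost (Leq (Add (Var x) (Const 1)) hi)).+1.
    by rewrite /=; lia.
  constructor; rewrite safe_eval /= ?xk ?dhi ?shi; last lia.
  by congr (Some _); lia.
have lt_lo : lo < N by lia.
have [xk shi dhi] := Ihi _ _ Is.
have bd : lo <= lo < N by rewrite leqnn.
have [t1 [s1 [E1 le1 [x1 I1]]]] := Ibody _ _ bd Is.
have Ibody' k s' : lo.+1 <= k < N -> I k s' -> runs W body s' (T k)
    (fun s' => var s' x = k /\ I k.+1 (set_var s' x k.+1)).
  by move=> bk; apply: Ibody; lia.
have /(_ _ lt_lo Ibody' _ I1) [|t2 [s2 [E2 le2 I2]]] := IHm lo.+1; first lia.
rewrite big_ltn //.
exists ((ecost (Leq (Add (Var x) (Const 1)) hi)).+1 + (t1 + 4) + t2), s2.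
split=> //; last by rewrite /=; lia.
apply: (@ExecWhileTrue _ _ _ _ (set_var s1 x lo.+1) _ _ _ 1) => //.
  rewrite safe_eval /= ?xk ?dhi ?shi; last lia.
  by congr (Some _); lia.
apply: ExecSeq E1 _.
have -> : lo.+1 = den s1 (Add (Var x) (Const 1)) by rewrite /= x1 addn1.
by apply: ExecAssign; rewrite safe_eval //= x1; lia.
Qed.

(** * Splits into two cliques *)

Definition clique_split (G : sgraph) (c : G -> bool) : Prop :=
  (forall x y, x != y -> c x = c y -> adj x y) /\
  (forall x, #|[set y | adj x y & c y != c x]| <= 2).

(** This symmetry later allows the assumption that the majority of the first five vertices is
    colored [true]. *)
Lemma clique_split_neg (G : sgraph) (c : G -> bool) :
  clique_split c -> clique_split (fun x => ~~ c x).
Proof.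
move=> [cl cr]; split=> [x y xy /negb_inj|x]; first exact: cl.
have -> : [set y | adj x y & ~~ c y != ~~ c x] = [set y | adj x y & c y != c x].
  by apply/setP=> y; rewrite !inE (inj_eq negb_inj).
exact: cr.
Qed.

(* Of the at most two ends of an edge, each lies on at most one edge of the
   other color. *)
Lemma CL_clique_split (G : sgraph) :
  proper_2_color_line G -> exists c : G -> bool, clique_split c.
Proof.
move=> [H [phi [phi_proper [f /bij_inj f_inj fadj]]]].
have bit (i j : 'I_2) : (i == j) = ((i == ord0) == (j == ord0)).
  by case: i => [[|[|i]] ?] //; case: j => [[|[|j]] ?].
exists (fun x => phi (f x) == ord0); split=> [x y xy c_xy|x].
  by rewrite -fadj /= /CL_adj (inj_eq f_inj) xy /= bit c_xy eqxx orbT.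
have [a [b def_fx]] : exists a b, val (f x) = [set a; b].
  have := valP (f x); rewrite inE => /existsP[a /existsP[b /andP[_ /eqP ->]]].
  by exists a, b.
set S := [set y | _ & _].
have inSP y : y \in S -> phi (f y) != phi (f x) /\ share_end (f x) (f y).
  rewrite inE -fadj /= /CL_adj -bit => /andP[/andP[_ sh] ne]; split=> //.
  by move: sh; rewrite [phi (f x) == _]eq_sym (negPf ne) orbF.
have same y z v : y \in S -> z \in S -> v \in val (f y) -> v \in val (f z) ->
    y = z.
  move=> /inSP[cy _] /inSP[cz _] vy vz; apply: f_inj; apply/eqP.
  apply: contraT => yz; have: phi (f y) != phi (f z).
    by apply: phi_proper => //; apply/set0Pn; exists v; rewrite inE vy.
  move: cy cz; rewrite (bit (phi (f y)) (phi (f x))).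
  rewrite (bit (phi (f z)) (phi (f x))) (bit (phi (f y)) (phi (f z))).
  by case: (phi (f y) == _); case: (phi (f z) == _); case: (phi (f x) == _).
(* An edge meeting [f x] contains [a] or [b], so by [same] the Boolean [a \in val (f y)] determines
   [y], and [bool] has two elements. *)
have inj : {in S &, injective (fun y => a \in val (f y))}.
  move=> y z yS zS /= eq_a; case ay: (a \in val (f y)).
    by apply: (same y z a) => //; rewrite -eq_a.
  have inb u : u \in S -> a \notin val (f u) -> b \in val (f u).
    move=> /inSP[_ /set0Pn[v]]; rewrite inE def_fx !inE.
    by case/andP=> /orP[] /eqP-> // ->.
  by apply: (same y z b) => //; apply: inb; rewrite // -?eq_a ay.
by rewrite -(card_in_imset inj) -card_bool max_card.
Qed.

(** Double counting of incidences: [y |-> [set x; y]] embeds the neighbors of [x] into the edges at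
    [x], and an edge has at most two elements. This bounds the total length of the adjacency
    lists. *)
Lemma handshake_leq (G : sgraph) :
  \sum_(x : G) #|[pred y | adj x y]| <= 2 * #|edges G|.
Proof.
have deg_le (x : G) :
    #|[pred y | adj x y]| <= \sum_(E in edges G) (x \in E).
  have inj : {in [pred y | adj x y] &, injective (fun y => [set x; y])}.
    move=> y z; rewrite !inE => xy xz /setP/(_ y); rewrite !inE eqxx orbT.
    by case: (y =P x) xy => [->|_ _ /esym/eqP //]; rewrite adj_irr.
  rewrite -(card_in_imset inj) -big_mkcondr sum1_card /=.
  apply: subset_leq_card; apply/subsetP=> E /imsetP[y]; rewrite !inE => xy ->.
  rewrite unfold_in !inE eqxx andbT.
  by apply/existsP; exists x; apply/existsP; exists y; rewrite xy eqxx.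
apply: (@leq_trans (\sum_(x : G) \sum_(E in edges G) (x \in E))).
  exact: leq_sum.
rewrite exchange_big mulnC -sum_nat_const leq_sum // => E.
rewrite inE => /existsP[x /existsP[y /andP[_ /eqP->]]].
by rewrite -big_mkcond sum1_card cards2; case: (_ != _).
Qed.

(** * The recognition program *)

Definition color_code (b : bool) : nat := (~~ b).+1.

(* Registers: 0 = number of vertices, 1 = current vertex, 2 = position in the
   adjacency lists, 3 and 4 = counters, 5 = success flag.  Arrays: 0 and 1 = the
   input, 2 = colors, 3 = the first two neighbors of each vertex v in the other
   class (cells 2v and 2v + 1, filled up with v), 4 = class sizes by color. *)

Definition seed_program (b : 5.-tuple bool) : cmd :=
  foldr (fun i => Seq (Put 2 (Const i) (Const (color_code (nth false b i)))))
    Skip (iota 0 5).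

Definition for_neighbors : cmd -> cmd := For 2 (Get 0 (Add (Var 1) (Const 1))).

Definition seed_step : cmd :=
  If (Leq (Get 1 (Var 2)) (Const 4))
     (Assign 3 (Add (Var 3) (Eqn (Get 2 (Get 1 (Var 2))) (Const 1)))) Skip.

(** The first five vertices keep their seed color. For the others, 2 minus the truth value of
    [3 <= r3], with [r3] the content of register 3, is the color code of that test. *)
Definition color_vertex : cmd :=
  Seq (If (Leq (Const 5) (Var 1))
          (Seq (Seq (Assign 3 (Const 0)) (Assign 2 (Get 0 (Var 1))))
               (Seq (for_neighbors seed_step)
                    (Put 2 (Var 1)
                       (Defs.Sub (Const 2) (Leq (Const 3) (Var 3))))))
          Skip)
      (Put 4 (Get 2 (Var 1)) (Add (Get 4 (Get 2 (Var 1))) (Const 1))).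

(** Only the first two cross neighbors are stored, but register 4 goes on counting, so that a third
    one is noticed by the final test. *)
Definition check_step : cmd :=
  If (Eqn (Get 2 (Get 1 (Var 2))) (Get 2 (Var 1)))
     (Assign 3 (Add (Var 3) (Const 1)))
     (Seq (If (Leq (Var 4) (Const 1))
              (Put 3 (Add (Add (Var 1) (Var 1)) (Var 4)) (Get 1 (Var 2))) Skip)
          (Assign 4 (Add (Var 4) (Const 1)))).

(** The products act as conjunctions, so a failure at one vertex persists in register 5. *)
Definition check_vertex : cmd :=
  Seq (Seq (Assign 3 (Const 0))
      (Seq (Assign 4 (Const 0))
      (Seq (Put 3 (Add (Var 1) (Var 1)) (Var 1))
      (Seq (Put 3 (Add (Add (Var 1) (Var 1)) (Const 1)) (Var 1))
           (Assign 2 (Get 0 (Var 1)))))))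
  (Seq (for_neighbors check_step)
       (Assign 5 (Mul (Var 5)
          (Mul (Eqn (Add (Var 3) (Const 1)) (Get 4 (Get 2 (Var 1))))
               (Leq (Var 4) (Const 2)))))).

Definition for_vertices : cmd -> cmd := For 1 (Var 0).

Definition try_seed (b : 5.-tuple bool) : cmd :=
  Seq (Seq (seed_program b)
      (Seq (Put 4 (Const 1) (Const 0))
      (Seq (Put 4 (Const 2) (Const 0)) (Assign 1 (Const 0)))))
  (Seq (for_vertices color_vertex)
  (Seq (Seq (Assign 5 (Const 1)) (Assign 1 (Const 0)))
       (for_vertices check_vertex))).

(** After a success the remaining seeds are skipped, so the arrays keep the split that was found. *)
Definition try_seeds (bs : seq (5.-tuple bool)) : cmd :=
  foldr (fun b => Seq (If (Var 5) Skip (try_seed b))) Skip bs.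

Definition put_end (k : nat) : cmd :=
  Seq (Assign 2 (Get 3 (Add (Add (Var 1) (Var 1)) (Const k))))
      (If (Leq (Add (Var 2) (Const 1)) (Var 1))
          (Put k (Var 1) (Add (Add (Var 2) (Var 2))
             (Defs.Sub (Const 1) (Eqn (Get 3 (Add (Var 2) (Var 2))) (Var 1)))))
          (Put k (Var 1) (Add (Add (Var 1) (Var 1)) (Const k)))).

(** The ends overwrite the input in arrays 0 and 1, which is safe because only array 3 is read from
    here on. Array 2 already holds the colors in the output format. *)
Definition write_output : cmd :=
  Seq (Assign 1 (Const 0))
  (Seq (for_vertices (Seq (put_end 0) (put_end 1)))
  (Seq (Assign 1 (Add (Var 0) (Var 0)))
  (Seq (Assign 2 (Var 0)) (Assign 0 (Const 1))))).

Definition recognizer : cmd :=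
  Seq (try_seeds (enum {: 5.-tuple bool}))
      (If (Var 5) write_output (Assign 0 (Const 0))).

(** * What the program computes *)

Definition seed_color (L : nat -> seq nat) (b : 5.-tuple bool) (v : nat) :=
  if v < 5 then nth false b v
  else 2 < count (fun w => (w < 5) && nth false b w) (L v).

Definition cross (c : nat -> bool) (v : nat) (l : seq nat) : seq nat :=
  [seq w <- l | c w != c v].

Definition check (L : nat -> seq nat) (n : nat) (c : nat -> bool) (v : nat) :=
  ((count (fun w => c w == c v) (L v)).+1
     == count (fun u => c u == c v) (iota 0 n))
  && (size (cross c v (L v)) <= 2).

(* The two ends of edge v of H: vertex number 2v + k is shared by v and its
   k-th cross neighbor w, if v < w; the shared vertex with a smaller cross
   neighbor w is found by locating v in the list of w.  Numbers that are not the
   end of any edge are isolated vertices of H. *)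
Definition end_of (X : nat -> seq nat) (v k : nat) : nat :=
  let w := nth v (X v) k in
  if w < v then w + w + (nth w (X w) 0 != v) else v + v + k.

(** * Correctness and running time of the program *)

Section Correctness.

Variables (n M W : nat) (off tgt : nat -> nat) (L : nat -> seq nat).
Hypothesis off0 : off 0 = 0.
Hypothesis offS : forall v, v < n -> off v.+1 = off v + size (L v).
Hypothesis off_le : forall v, v <= n -> off v <= M.
Hypothesis tgtE : forall v k, v < n -> k < size (L v) ->
  tgt (off v + k) = nth 0 (L v) k.
Hypothesis L_lt : forall v w, v < n -> w \in L v -> w < n.
Hypothesis W_ge : M + n + n + 6 <= W.

Definition holds_input (s : state) : Prop :=
  [/\ var s 0 = n, arr s 0 =1 off & arr s 1 =1 tgt].

(** The invariant is indexed by the prefix of [L v] scanned so far, not by a position in the array,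
    and must survive any new value of register 2, the loop counter. The 13 is the loop overhead for
    a bound expression of cost 4; the extra round pays for the failing test. *)
Lemma runs_neighbors body v (J : seq nat -> state -> Prop) s :
  v < n ->
  (forall l s, J l s -> holds_input s /\ var s 1 = v) ->
  (forall l w r s, L v = l ++ w :: r -> size l < M -> w < n ->
     J l s -> arr s 1 (var s 2) = w -> var s 2 < M ->
     wp W body s (fun s' => var s' 2 = var s 2 /\
                            forall j, J (rcons l w) (set_var s' 2 j))) ->
  var s 2 = off v -> J [::] s ->
  runs W (for_neighbors body) s
    ((size (L v)).+1 * (loop_free_cost body + 13)) (J (L v)).
Proof.
move=> v_n Jin Jbody s2 Js.
have offv := offS v_n; have offM := off_le v_n.
pose I k s := var s 2 = k /\ J (take (k - off v) (L v)) s.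
have := @runs_for W 2 (Get 0 (Add (Var 1) (Const 1))) body I
  (fun=> loop_free_cost body) (off v) (off v.+1) s.
case; [lia|lia| | | |].
- move=> k s' [s'2 J']; have [[_ s'0 _] s'1] := Jin _ _ J'.
  by split=> //=; rewrite s'0 s'1 ?addn1 //; lia.
- move=> k s' /andP[ge_k lt_k] [s'2 J'].
  have lt_kL : k - off v < size (L v) by lia.
  have [[_ _ s't] _] := Jin _ _ J'.
  have tgtk : arr s' 1 (var s' 2) = nth 0 (L v) (k - off v).
    by rewrite s't s'2 -tgtE // subnKC.
  apply: runs_weaken (runs_wp _) (leqnn _) _.
    apply: (Jbody _ _ (drop (k - off v).+1 (L v)) _ _ _ _ J' tgtk); last lia.
    - by rewrite -drop_nth // cat_take_drop.
    - by rewrite size_take lt_kL; lia.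
    - by apply: (L_lt v_n); apply: mem_nth.
  move=> s'' [s''2 J'']; split; first by rewrite s''2.
  rewrite /I /=; split=> //; rewrite subSn // (take_nth 0) //.
- by rewrite /I subnn take0.
move=> t [s' [E le_t [s'2 J']]]; exists t, s'; split=> //.
  apply: leq_trans le_t _; rewrite sum_nat_const_nat /=.
  by rewrite mulSn addnC leq_add ?leq_mul //; lia.
by move: J'; rewrite offv addKn take_size.
Qed.

(** The amortization that makes the time linear: costs affine in the degree sum to
    [a * n + b * off n], and [off n <= M]. *)
Lemma runs_vertices body (I : nat -> state -> Prop) a b s :
  (forall v s, I v s -> var s 1 = v /\ var s 0 = n) ->
  (forall v s, v < n -> I v s ->
     runs W body s (a + b * size (L v))
       (fun s' => var s' 1 = v /\ I v.+1 (set_var s' 1 v.+1))) ->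
  I 0 s ->
  runs W (for_vertices body) s ((a + b + 10) * (n + M + 1)) (I n).
Proof.
move=> Iv Ibody I0.
have := @runs_for W 1 (Var 0) body I (fun v => a + b * size (L v)) 0 n s.
case=> //; [lia| |].
- by move=> k s' /Iv[s'1 s'0]; split=> //=; lia.
move=> t [s' [E le_t Is']]; exists t, s'; split=> //; apply: leq_trans le_t _.
have sumL m : m <= n -> \sum_(0 <= v < m) size (L v) = off m.
  elim: m => [|m IHm] m_n; first by rewrite big_geq.
  by rewrite big_nat_recr //= IHm ?offS //; lia.
rewrite !big_split /= -big_distrr /= sumL // !sum_nat_const_nat subn0.
by have := off_le (leqnn n); nia.
Qed.

Lemma color_codeK b : (color_code b == 1) = b.
Proof. by case: b. Qed.

Lemma color_code_inj b b' : (color_code b == color_code b') = (b == b').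
Proof. by case: b; case: b'. Qed.

Lemma color_code_le b : 0 < color_code b <= 2.
Proof. by case: b. Qed.

(** The first five cells hold the seed from the start, whatever [k] is, because every later vertex
    is colored by looking at them. *)
Definition colored (c : nat -> bool) (k : nat) (s : state) : Prop :=
  forall u, (u < 5) || (u < k) -> arr s 2 u = color_code (c u).

Definition class_sizes (c : nat -> bool) (k : nat) (s : state) : Prop :=
  forall b, arr s 4 (color_code b) = count (fun u => c u == b) (iota 0 k).

Lemma color_vertex_runs seed v s :
  let c := seed_color L seed in
  v < n -> holds_input s -> var s 1 = v -> colored c v s -> class_sizes c v s ->
  runs W color_vertex s (100 + 100 * size (L v))
    (fun s' => [/\ holds_input s', var s' 1 = v, colored c v.+1 s' &
                   class_sizes c v.+1 s']).
Proof.
move=> c v_n in_s s1 col_s cls_s.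
pose Q s' := [/\ holds_input s', var s' 1 = v, colored c v.+1 s' &
                 class_sizes c v s'].
apply: (@runs_budget (8 + (50 + 50 * size (L v)) + loop_free_cost
  (Put 4 (Get 2 (Var 1)) (Add (Get 4 (Get 2 (Var 1))) (Const 1))))).
  by rewrite /=; lia.
apply: (@runs_seq _ _ _ _ _ _ Q); last first.
  move=> s' [in_s' s'1 col_s' cls_s']; apply: runs_wp => /=.
  have col_v : arr s' 2 v = color_code (c v) by apply: col_s'; lia.
  have cnt_le := count_size (fun u => c u == c v) (iota 0 v).
  rewrite size_iota in cnt_le.
  have := color_code_le (c v); rewrite s'1 col_v cls_s' => le2.
  split; first lia.
  split=> // b; rewrite -[v.+1]addn1 iotaD count_cat /= color_code_inj.
  rewrite add0n addn0 [b == _]eq_sym.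
  case: eqP => [<-|_]; last by rewrite addn0 cls_s'.
  by rewrite addn1.
have colS s' : arr s' 2 v = color_code (c v) ->
    (forall u, (u < 5) || (u < v) -> arr s' 2 u = arr s 2 u) ->
    colored c v.+1 s'.
  move=> s'v s's u; case: (u =P v) => [-> //|uv ltu].
  by rewrite s's; [apply: col_s|]; lia.
have -> : 8 + (50 + 50 * size (L v)) =
  (ecost (Leq (Const 5) (Var 1))).+1 + (54 + 50 * size (L v)) by rewrite /=; lia.
apply: runs_if => /= [|ge5|lt5]; first lia; last first.
  exists 1, s; split=> //; first by constructor.
  by split=> //; apply: colS => //; apply: col_s; lia.
have v5 : (v < 5) = false by lia.
pose J l s' := [/\ holds_input s' /\ var s' 1 = v, colored c v s',
  class_sizes c v s' &
  var s' 3 = count (fun w => (w < 5) && nth false seed w) l].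
have [s0 soff stgt] := in_s.
apply: (@runs_budget
  (loop_free_cost (Seq (Assign 3 (Const 0)) (Assign 2 (Get 0 (Var 1)))) +
    ((size (L v)).+1 * (loop_free_cost seed_step + 13) +
     loop_free_cost
       (Put 2 (Var 1) (Defs.Sub (Const 2) (Leq (Const 3) (Var 3))))))).
  by rewrite /=; lia.
apply: runs_wp_seq => /=; split; first lia.
rewrite s1 soff; have offM := off_le (ltnW v_n); split; first lia.
apply: (runs_seq (Q1 := J (L v))).
  apply: runs_neighbors => //; first by move=> l s' [].
  move=> l w r s' Lv lt_l w_n [[in_s' s'1] col_s' cls_s' s'3] s't s'2 /=.
  have cnt_le := count_size (fun w => (w < 5) && nth false seed w) l.
  rewrite s't s'3; split; first lia.
  rewrite /J; split=> w5.
    have w5' : w < 5 by lia.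
    rewrite (col_s' w) ?w5' // color_codeK.
    have := color_code_le (c w); split; first lia.
    split=> // j; split=> //=.
    by rewrite -cats1 count_cat /= addn0 /c /seed_color w5'.
  split=> // j; split=> //=.
  by rewrite -cats1 count_cat /= addn0 s'3; lia.
move=> s' [[in_s' s'1] col_s' cls_s' s'3]; apply: runs_wp => /=.
have cnt_le := count_size (fun w => (w < 5) && nth false seed w) (L v).
have := offS v_n; have := off_le v_n; rewrite s'1 s'3 => h1 h2.
split; first lia.
split=> //.
move=> u; rewrite /=; case: eqP => [-> _|uv ltu]; last by apply: col_s'; lia.
by rewrite /c /seed_color v5; case: (2 < _).
Qed.

Definition colored_input (c : nat -> bool) (s : state) : Prop :=
  [/\ holds_input s, colored c n s & class_sizes c n s].

Definition crossed (c : nat -> bool) (k : nat) (s : state) : Prop :=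
  forall u j, u < k -> j < 2 ->
    arr s 3 (u + u + j) = nth u (cross c u (L u)) j.

Lemma check_vertex_runs c v (ok : bool) s :
  v < n -> colored_input c s -> var s 1 = v -> var s 5 = ok -> crossed c v s ->
  runs W check_vertex s (200 + 100 * size (L v))
    (fun s' => [/\ colored_input c s', var s' 1 = v,
                   var s' 5 = ok && check L n c v & crossed c v.+1 s']).
Proof.
move=> v_n in_s s1 s5 cr_s.
(* With default [v], the clause on [nth] holds for the empty prefix once both cells contain [v]; a
   third cross neighbor does not affect it because [j < 2]. *)
pose J l s' := [/\ colored_input c s', var s' 1 = v /\ var s' 5 = ok,
  crossed c v s',
  var s' 3 = count (fun w => c w == c v) l /\ var s' 4 = size (cross c v l) &
  forall j, j < 2 -> arr s' 3 (v + v + j) = nth v (cross c v l) j].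
have offM := off_le (ltnW v_n).
have [[s0 soff stgt] col_s cls_s] := in_s.
apply: (@runs_budget (loop_free_cost
    (Seq (Assign 3 (Const 0)) (Seq (Assign 4 (Const 0))
    (Seq (Put 3 (Add (Var 1) (Var 1)) (Var 1))
    (Seq (Put 3 (Add (Add (Var 1) (Var 1)) (Const 1)) (Var 1))
    (Assign 2 (Get 0 (Var 1))))))) +
  ((size (L v)).+1 * (loop_free_cost check_step + 13) +
   loop_free_cost (Assign 5 (Mul (Var 5)
     (Mul (Eqn (Add (Var 3) (Const 1)) (Get 4 (Get 2 (Var 1))))
          (Leq (Var 4) (Const 2)))))))).
  by rewrite /=; lia.
apply: runs_wp_seq; rewrite /= s1 soff.
do 5![split; first lia].
apply: (runs_seq (Q1 := J (L v))).
  apply: runs_neighbors => //.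
  - by move=> l s' [[in_s' _ _] [s'1 _] _ _ _].
  - move=> l w r s' Lv lt_l w_n [in_s' [s'1 s'5] cr_s' [s'3 s'4] crv] s't s'2.
    have [_ col_s' _] := in_s'.
    have cnt_le := count_size (fun w => c w == c v) l.
    have cross_le : size (cross c v l) <= size l.
      by rewrite size_filter count_size.
    have := color_code_le (c w); have := color_code_le (c v) => le_v le_w.
    rewrite /= s'1 s't (col_s' w) ?w_n ?orbT // (col_s' v) ?v_n ?orbT //.
    rewrite /J color_code_inj; split; first lia.
    have -> : cross c v (rcons l w) = if c w != c v
        then rcons (cross c v l) w else cross c v l.
      by rewrite /cross filter_rcons.
    split=> [same|other].
      split; first lia.
      split=> // j; split=> //=.
        by rewrite -cats1 count_cat /= s'3 s'4; case: eqP same.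
      by case: eqP same.
    have diff : c w != c v by lia.
    rewrite diff.
    split; first lia.
    (* Either a cell is free and receives [w], or both are taken and only the counter moves. *)
    split=> d_le; rewrite s'4 in d_le *.
      split; first lia.
      split; first lia.
      split=> // j; split=> //=.
      + move=> u i u_v i2; rewrite -cr_s' //=.
        by case: eqP => //; lia.
      + rewrite -cats1 count_cat /= (negPf diff) size_rcons s'3; lia.
      + move=> i i2; rewrite nth_rcons eqn_add2l crv //.
        case: ltngtP => // lt_i; rewrite nth_default //; lia.
    split; first lia.
    split=> // j; split=> //=.
    + by rewrite -cats1 count_cat /= (negPf diff) size_rcons s'3; lia.
    + move=> i i2; rewrite nth_rcons crv //.
      by case: ltngtP => //; lia.
  - split=> //=.
      move=> u j u_v j2; rewrite /= -cr_s //=.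
      by do 2![case: eqP; first lia].
    case=> [|[|j]] //= _; rewrite ?addn0 ?eqxx //.
    by case: eqP => //; lia.
move=> s' [in_s' [s'1 s'5] cr [s'3 s'4] crv]; apply: runs_wp.
have [_ col_s' cls_s'] := in_s'.
have cnt_le := count_size (fun w => c w == c v) (L v).
have cross_le : size (cross c v (L v)) <= size (L v).
  by rewrite size_filter count_size.
have cls_le := count_size (fun w => c w == c v) (iota 0 n).
have := color_code_le (c v); have := offS v_n; have := off_le v_n.
rewrite size_iota in cls_le => h1 h2 h3.
rewrite /= s'1 (col_s' v) ?v_n ?orbT // cls_s' s'3 s'4 s'5 addn1.
rewrite !mulnb -/(check L n c v); split; first lia.
split=> //= u j; rewrite ltnS leq_eqVlt => /orP[/eqP->|]; first exact: crv.
exact: cr.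
Qed.

Definition accepts (b : 5.-tuple bool) : bool :=
  all (check L n (seed_color L b)) (iota 0 n).

Definition split_found (b : 5.-tuple bool) (s : state) : Prop :=
  colored_input (seed_color L b) s /\ crossed (seed_color L b) n s.

Lemma try_seed_runs b s :
  holds_input s ->
  runs W (try_seed b) s (1000 * (n + M + 1))
    (fun s' => split_found b s' /\ var s' 5 = accepts b).
Proof.
move=> in_s; pose c := seed_color L b.
apply: (@runs_budget (80 + ((100 + 100 + 10) * (n + M + 1) +
   (10 + (200 + 100 + 10) * (n + M + 1))))); first by lia.
have cc i := color_code_le (nth false b i).
apply: (runs_seq (Q1 := fun s' => [/\ holds_input s', var s' 1 = 0,
    colored c 0 s' & class_sizes c 0 s'])).
  apply: runs_budget (runs_wp _) => //=.
  have := cc 0; have := cc 1; have := cc 2; have := cc 3; have := cc 4.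
  move=> c4 c3 c2 c1 c0; do 8![split; first lia].
  split=> //; last by case.
  case=> [|[|[|[|[|u]]]]] //= _; rewrite /c /seed_color //.
move=> s1 [in_s1 s1_1 col1 cls1].
apply: (runs_seq (Q1 := colored_input c)).
  pose I v s' := [/\ holds_input s', var s' 1 = v, colored c v s' &
                     class_sizes c v s'].
  have := @runs_vertices color_vertex I 100 100 s1; case=> //.
  - by move=> v s' [[]].
  - move=> v s' v_n [in_s' s'1 col_s' cls_s'].
    apply: runs_weaken (color_vertex_runs v_n in_s' s'1 col_s' cls_s') _ _ => //.
    by move=> s'' [].
  - move=> t [s' [E le_t [in_s' _ col_s' cls_s']]].
    by exists t, s'.
move=> s2 in_s2; have [[s2_0 _ _] _ _] := in_s2.
apply: (runs_seq (Q1 := fun s' => [/\ colored_input c s', var s' 1 = 0 &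
    var s' 5 = 1])).
  by apply: runs_budget (runs_wp _) => //=; split; [lia|split; [lia|]].
move=> s3 [in_s3 s3_1 s3_5].
pose I v s' := [/\ colored_input c s', var s' 1 = v,
   var s' 5 = all (check L n c) (iota 0 v) & crossed c v s'].
have := @runs_vertices check_vertex I 200 100 s3; case=> //.
- by move=> v s' [[[]]].
- move=> v s' v_n [in_s' s'1 s'5 cr].
  apply: runs_weaken (check_vertex_runs v_n in_s' s'1 s'5 cr) _ _ => //.
  move=> s'' [in_s'' s''1 s''5 cr'']; split=> //; split=> //.
  by rewrite -[v.+1]addn1 iotaD all_cat /= andbT.
move=> t [s' [E le_t [in_s' _ s'5 cr]]].
by exists t, s'.
Qed.

(** Once register 5 is 1, the state keeps the data of an accepting seed. The failing alternative
    records that the flag was 0 at the start, which in the induction rules out a failure after an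
    earlier success. *)
Lemma try_seeds_runs bs s :
  holds_input s ->
  var s 5 = 0 \/ (exists b, [/\ split_found b s, accepts b & var s 5 = 1]) ->
  runs W (try_seeds bs) s ((size bs).+1 * (1003 * (n + M + 1)))
    (fun s' =>
       (exists b, [/\ split_found b s', accepts b & var s' 5 = 1]) \/
       [/\ var s 5 = 0, var s' 5 = 0 & all (fun b => ~~ accepts b) bs]).
Proof.
elim: bs s => [|b bs IHbs] s in_s found_s.
  exists 1, s; split; [by constructor|by lia|].
  by case: found_s => found_s; [right|left].
rewrite mulSn.
pose Q s' := (exists b, [/\ split_found b s', accepts b & var s' 5 = 1]) \/
  [/\ holds_input s', var s 5 = 0, var s' 5 = 0 & ~~ accepts b].
apply: (runs_seq (Q1 := Q)).
  apply: (@runs_budget ((ecost (Var 5)).+1 + 1000 * (n + M + 1))).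
    by rewrite /=; lia.
  have le1 : var s 5 <= 1 by case: found_s => [->|[b' [_ _ ->]]].
  apply: runs_if => [|ok|fail]; first by rewrite /=; lia.
    exists 1, s; split; [by constructor|by lia|left].
    by case: found_s => // s0; rewrite /= s0 in ok.
  apply: runs_weaken (try_seed_runs b in_s) (leqnn _) _.
  move=> s' [fs' s'5]; case ab: (accepts b); rewrite ab in s'5.
    by left; exists b.
  by right; split; rewrite ?ab //; case: fs' => [[]].
move=> s' Qs'; have in_s' : holds_input s'.
  by case: Qs' => [[b' [[[]]]]|[]].
have [|t [s'' [E le_t post]]] := IHbs _ in_s'.
  by case: Qs' => [?|[]]; [right|left].
exists t, s''; split=> //; case: post => [|[s'5 s''5 rej]]; first by left.
right; case: Qs' => [[b' [_ _ s'1]]|[_ s5 _ rejb]]; first by rewrite s'1 in s'5.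
by split; rewrite //= rejb.
Qed.

Definition output_written (c : nat -> bool) (s : state) : Prop :=
  let X v := cross c v (L v) in
  [/\ var s 0 = 1, var s 1 = n + n, var s 2 = n &
      forall v, v < n -> [/\ arr s 0 v = end_of X v 0,
                             arr s 1 v = end_of X v 1 &
                             arr s 2 v = color_code (c v)]].

(** Register 2 is scratch, so [Q] has to hold for every value left in it. *)
Lemma put_end_wp c k v s (Q : state -> Prop) :
  k < 2 -> v < n -> var s 1 = v -> crossed c n s ->
  (forall u, Q (set_arr (set_var s 2 u) k v
                  (end_of (fun v => cross c v (L v)) v k))) ->
  wp W (put_end k) s Q.
Proof.
move=> k2 v_n s1 cr_s HQ; rewrite /= s1 cr_s //.
(* The default [u] makes every cell read a vertex number, even where a cross neighbor is missing;
   this keeps all sums within the word size. *)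
have X_lt u i : u < n -> nth u (cross c u (L u)) i < n.
  move=> u_n; case: (ltnP i (size (cross c u (L u)))) => i_lt.
    by have := mem_nth u i_lt; rewrite mem_filter => /andP[_ /(L_lt u_n)].
  by rewrite nth_default.
have := HQ (nth v (cross c v (L v)) k); rewrite /end_of.
set w := nth v _ k; have w_n : w < n by apply: X_lt.
have := X_lt w 0 w_n; rewrite -(cr_s w 0 w_n) // addn0 => ww_n Qs.
split; first lia.
split; first lia.
split=> [lt_wv|ge_wv]; (split; first lia).
  have lt_wv' : w < v by lia.
  move: Qs; rewrite lt_wv'; congr (Q (set_arr _ _ _ _)).
  by case: (_ == v).
by move: Qs; case: ltnP => //; lia.
Qed.

Lemma write_output_runs c s :
  var s 0 = n -> colored c n s -> crossed c n s ->
  runs W write_output s (200 * (n + M + 1)) (output_written c).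
Proof.
move=> s0 col_s cr_s; pose X v := cross c v (L v).
pose I v s' := [/\ var s' 1 = v /\ var s' 0 = n, colored c n s', crossed c n s' &
  forall u, u < v -> arr s' 0 u = end_of X u 0 /\ arr s' 1 u = end_of X u 1].
apply: (@runs_budget (2 + ((100 + 0 + 10) * (n + M + 1) + 10))); first by lia.
apply: (runs_seq (Q1 := I 0)) => [|s1 I1]; last first.
  apply: (runs_seq (Q1 := I n)); last first.
    move=> s' [[s'1 s'0] col_s' cr_s' out].
    apply: runs_budget (runs_wp _) => //=.
    rewrite s'0; do 3![split; first lia].
    split=> //= v v_n; have [-> ->] := out v v_n; split=> //.
    by apply: col_s'; rewrite v_n orbT.
  apply: runs_vertices I1; first by move=> v s' [].
  move=> v s' v_n [[s'1 s'0] col_s' cr_s' out].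
  apply: runs_budget (runs_wp _); first by rewrite /=; lia.
  apply: (put_end_wp (c := c) (v := v)) => // u1.
  apply: (put_end_wp (c := c) (v := v)) => // u2.
  split=> //; split=> // u; rewrite ltnS leq_eqVlt /=.
  by case: eqP => [->|_] //= /out.
by apply: runs_budget (runs_wp _).
Qed.

(** The factor 33 is [2 ^ 5 + 1]: there are 32 seeds, and [try_seeds_runs] charges one more round.
    The summand 203 covers the final test and the output. *)
Lemma recognizer_runs s :
  holds_input s -> var s 5 = 0 ->
  runs W recognizer s ((33 * 1003 + 203) * (n + M + 1))
    (fun s' => (exists2 b, accepts b & output_written (seed_color L b) s') \/
               (var s' 0 = 0 /\ forall b, ~~ accepts b)).
Proof.
move=> in_s s5.
apply: (@runs_budget ((size (enum {: 5.-tuple bool})).+1 * (1003 * (n + M + 1))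
  + ((ecost (Var 5)).+1 + 200 * (n + M + 1)))).
  by rewrite -cardE card_tuple card_bool [ecost _]/=; lia.
apply: runs_seq (try_seeds_runs _ in_s (or_introl s5)) _ => s' post.
apply: runs_if => [|/= ok|/= fail].
- by rewrite /=; case: post => [[b [_ _ ->]]|[_ -> _]]; lia.
- case: post => [[b [[in_s' cr] ab _]]|[_ s'5 _]]; last by rewrite s'5 in ok.
  have [[s'0 _ _] col _] := in_s'.
  apply: runs_weaken (write_output_runs s'0 col cr) (leqnn _) _ => s'' out.
  by left; exists b.
case: post => [[b [_ _ s'5]]|[_ _ /allP rej]]; first by rewrite s'5 in fail.
apply: runs_budget (runs_wp _) => /=; first lia.
by split=> //; right; split=> // b; apply: rej; rewrite mem_enum.
Qed.

End Correctness.

(** * The ends of the edges of H *)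

Section EdgeEnds.

Variables (n : nat) (X : nat -> seq nat).
Hypothesis X_uniq : forall v, v < n -> uniq (X v).
Hypothesis X_size : forall v, v < n -> size (X v) <= 2.
Hypothesis X_sym : forall v w, v < n -> w \in X v ->
  [/\ w < n, w != v & v \in X w].

Lemma nth_cross v k :
  nth v (X v) k <> v -> k < size (X v) /\ nth v (X v) k \in X v.
Proof.
by case: (ltnP k (size (X v))) => [/[dup] /(mem_nth v)|/(nth_default v)->].
Qed.

(** As [X w] has at most two entries, the Boolean telling whether the first differs from [v] is,
    read as a number, the position of [v]. *)
Lemma nth_cross_locate w v :
  w < n -> v \in X w -> nth w (X w) (nth w (X w) 0 != v) = v.
Proof.
move=> /X_size; case: (X w) => [|p [|q [|r l]]] //= _; rewrite !inE.
  by move/eqP->; rewrite eqxx.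
by case: (p =P v) => //= pv; rewrite eq_sym => /orP[|] /eqP.
Qed.

(** Decodes a vertex [2a + j] of H seen from its edge [v]. Either [v] owns the number, its [k]-th
    cross neighbor being larger or, by default, absent; or the owner is the smaller cross neighbor
    [a], in whose list [v] has position [j]. *)
Lemma end_ofP v k a j : v < n -> k < 2 -> j < 2 -> end_of X v k = a + a + j ->
  [/\ a = v, j = k & v <= nth v (X v) k] \/
  [/\ a < v, nth v (X v) k = a & nth a (X a) j = v].
Proof.
rewrite /end_of => v_n k2 j2; case: ltnP => [lt_wv|ge_wv] def_a; last first.
  by left; split=> //; lia.
right; set w := nth v _ k in lt_wv def_a *.
have [|_ wX] := @nth_cross v k; first by rewrite -/w; lia.
have [w_n _ vX] := X_sym v_n wX.
have aw : a = w by lia.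
have jw : j = (nth w (X w) 0 != v) by lia.
by rewrite aw jw nth_cross_locate.
Qed.

Lemma end_of_lt v k : v < n -> k < 2 -> end_of X v k < n + n.
Proof. by move=> v_n k2; rewrite /end_of; case: (ltnP (nth v (X v) k)); lia. Qed.

(** Halving the common number gives its owner [a] and parity the slot [j], so each of [v] and [u]
    either is [a] or is entry [j] of [X a]. If exactly one is the owner, the two are cross
    neighbors. *)
Lemma end_of_inj v u k k' : v < n -> u < n -> k < 2 -> k' < 2 ->
  end_of X v k = end_of X u k' ->
  v = u /\ k = k' \/
  [/\ v <> u, nth v (X v) k = u & nth u (X u) k' = v].
Proof.
move=> v_n u_n k2 k'2 eq_e.
pose a := (end_of X v k)./2; pose j : nat := odd (end_of X v k).
have j2 : j < 2 by rewrite /j; lia.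
have ev : end_of X v k = a + a + j by rewrite /a /j; lia.
have eu : end_of X u k' = a + a + j by rewrite -eq_e.
case: (end_ofP v_n k2 j2 ev) => [[av jk ge_v]|[lt_a va aj]];
case: (end_ofP u_n k'2 j2 eu) => [[au jk' ge_u]|[lt_a' ua aj']].
- by left; split; congruence.
- right; split; [lia|congruence|congruence].
- right; split; [lia|congruence|congruence].
(* Neither owns the number: both are entry [j] of [X a], hence equal, and [a] occurs only once in
   their list. *)
have uv : v = u by congruence.
left; split=> //; move: (ua); rewrite -uv -va => /eqP.
have [|kX _] := @nth_cross v k; first by rewrite va; lia.
have [|k'X _] := @nth_cross v k'; first by rewrite uv ua; lia.
by rewrite nth_uniq // ?X_uniq // => /eqP.
Qed.

(** The shared vertex is owned by the smaller of the two, in the slot of the larger one; hence the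
    reduction to [v < u]. *)
Lemma end_of_share v u : v < n -> u \in X v ->
  exists k k', [/\ k < 2, k' < 2 & end_of X v k = end_of X u k'].
Proof.
wlog lt_vu : v u / v < u => [thm v_n uX|].
  have [u_n uv vX] := X_sym v_n uX.
  case: (ltngtP v u) uv => [lt_vu _|lt_uv _|] //.
    exact: thm.
  have [k [k' [k2 k'2 e]]] := thm _ _ lt_uv u_n vX.
  by exists k', k.
move=> v_n uX; have [u_n _ vX] := X_sym v_n uX.
pose j : nat := nth v (X v) 0 != u; exists j, (index v (X u)).
have vi := vX; rewrite -index_mem in vi.
have j2 : j < 2 by rewrite /j; case: (_ != _).
split=> //; first exact: leq_trans vi (X_size u_n).
rewrite /end_of nth_cross_locate // nth_index //.
by rewrite lt_vu ltnNge (ltnW lt_vu).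
Qed.

End EdgeEnds.

(** H has vertex set ['I_N] and the sets [ends x] as edges. Distinct edges meet exactly when they
    come from a crossing edge of G, which gives properness; edges of one color correspond to
    adjacent vertices because the classes are cliques. *)
Lemma ends_realize (G : sgraph) (c : G -> bool) N (e0 e1 : G -> 'I_N) :
  let ends x := [set e0 x; e1 x] in
  (forall x y, x != y -> c x = c y -> adj x y) ->
  (forall x, e0 x != e1 x) -> injective ends ->
  (forall x y, x != y ->
     (ends x :&: ends y != set0) = adj x y && (c x != c y)) ->
  exists (H : sgraph) (phi : edge H -> 'I_2),
    [/\ proper_coloring phi, giso G (CL phi) &
      exists (vx : 'I_N -> H) (ed : G -> edge H),
        [/\ bijective vx, bijective ed &
          forall x, (phi (ed x)).+1 = color_code (c x) /\
                    val (ed x) = [set vx (e0 x); vx (e1 x)]]].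
Proof.
move=> ends cliques e01 ends_inj shareE.
pose hadj a b := (a != b) && [exists x, [set a; b] == ends x].
have hsym : symmetric hadj by move=> a b; rewrite /hadj eq_sym setUC.
have hirr : irreflexive hadj by move=> a; rewrite /hadj eqxx.
pose H := SGraph hsym hirr.
have ends_edge x : ends x \in edges H.
  rewrite inE; apply/existsP; exists (e0 x); apply/existsP; exists (e1 x).
  by rewrite /= /hadj e01 eqxx andbT; apply/existsP; exists x.
pose ed x : edge H := exist _ (ends x) (ends_edge x).
have [g gK] : exists g : edge H -> G, forall E, ed (g E) = E.
  apply: (@fin_all_exists _ (fun=> G) (fun E x => ed x = E)) => -[E HE].
  have := HE; rewrite inE.
  case/existsP=> a /existsP[b /andP[/andP[_ /existsP[x /eqP Ex]] /eqP EE]].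
  by exists x; apply: val_inj; rewrite /= EE Ex.
have ed_inj : injective ed by move=> x y [] /ends_inj.
have edK : cancel ed g by move=> x; apply: ed_inj; rewrite gK.
have ed_bij : bijective ed by exists g.
pose phi (E : edge H) : 'I_2 := inord (~~ c (g E)).
have phiE x : phi (ed x) = ~~ c x :> nat.
  by rewrite /phi edK inordK //; case: (c x).
have phi_eq x y : (phi (ed x) == phi (ed y)) = (c x == c y).
  by rewrite -val_eqE /= !phiE; case: (c x); case: (c y).
exists H, phi; split.
- move=> E F; rewrite -(gK E) -(gK F) (inj_eq ed_inj) /share_end /= => xy.
  by rewrite phi_eq shareE // => /andP[].
- exists ed => // x y; rewrite /= /CL_adj (inj_eq ed_inj) phi_eq /share_end /=.
  case: (x =P y) => [->|/eqP xy]; first by rewrite adj_irr.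
  rewrite /= shareE //; case: (c x =P c y) => [/(cliques _ _ xy)->|_].
    by rewrite orbT.
  by rewrite andbT orbF.
exists id, ed; split=> //; first by exists id.
by move=> x; rewrite phiE.
Qed.

(** * Reading the adjacency lists *)

Lemma nth_flatten_shape (T : eqType) (x0 : T) (ss : seq (seq T)) i k :
  k < size (nth [::] ss i) ->
  nth x0 (flatten ss) (sumn (take i (shape ss)) + k) = nth x0 (nth [::] ss i) k.
Proof.
elim: ss i => [|s ss IHss] [|i] //=; rewrite ?nth_nil //= => lt_k.
  by rewrite nth_cat lt_k.
by rewrite nth_cat -addnA ltnNge leq_addr /= addKn IHss.
Qed.

Section AdjacencyLists.

Variables (G : sgraph) (A : adj_lists G).

Let n := size (Defs.order A).
Let num (x : G) : nat := index x (Defs.order A).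

Definition lists : seq (seq nat) :=
  [seq [seq index y (Defs.order A) | y <- nbrs A x] | x <- Defs.order A].

Let L : nat -> seq nat := nth [::] lists.

Lemma num_lt x : num x < n.
Proof. by rewrite index_mem order_mem. Qed.

Lemma num_inj : injective num.
Proof. by move=> x y; apply: (index_inj x); exact: order_mem. Qed.

Lemma num_onto v : v < n -> exists x, v = num x.
Proof.
rewrite /n; case def_o: (Defs.order A) => [//|x s]; rewrite -def_o => v_n.
by exists (nth x (Defs.order A) v); rewrite /num index_uniq // order_uniq.
Qed.

Lemma lists_num x : L (num x) = [seq num y | y <- nbrs A x].
Proof. by rewrite /L /lists (nth_map x) ?num_lt // nth_index // order_mem. Qed.

Lemma mem_lists x y : (num y \in L (num x)) = adj x y.
Proof. by rewrite lists_num mem_map ?nbrs_mem //; exact: num_inj. Qed.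

Lemma lists_lt v w : v < n -> w \in L v -> w < n.
Proof.
by move=> /num_onto[x ->]; rewrite lists_num => /mapP[y _ ->]; exact: num_lt.
Qed.

Lemma shape_lists : shape lists = [seq size (nbrs A x) | x <- Defs.order A].
Proof.
by rewrite /shape /lists -map_comp; apply: eq_map => x /=; rewrite size_map.
Qed.

Lemma nth_offsets v : v <= n -> nth 0 (offsets A) v = sumn (take v (shape lists)).
Proof.
move=> v_n; rewrite /offsets shape_lists.
by rewrite (nth_map 0) ?size_iota ?nth_iota.
Qed.

Lemma offsets_next v : v < n ->
  nth 0 (offsets A) v.+1 = nth 0 (offsets A) v + size (L v).
Proof.
move=> v_n; rewrite !nth_offsets // 1?ltnW //.
rewrite (take_nth 0) ?shape_lists ?size_map // -shape_lists.
by rewrite -cats1 sumn_cat /= addn0 /shape (nth_map [::]) // /lists size_map.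
Qed.

Lemma nth_targets v k : v < n -> k < size (L v) ->
  nth 0 (targets A) (nth 0 (offsets A) v + k) = nth 0 (L v) k.
Proof. by move=> v_n lt_k; rewrite nth_offsets 1?ltnW // nth_flatten_shape. Qed.

Lemma count_lists (p : pred nat) x :
  count p (L (num x)) = #|[set y | adj x y & p (num y)]|.
Proof.
rewrite lists_num count_map -size_filter -(card_uniqP _).
  by apply: eq_card => y; rewrite !inE mem_filter nbrs_mem andbC.
by rewrite filter_uniq // nbrs_uniq.
Qed.

Lemma count_order (p : pred nat) : count p (iota 0 n) = #|[set y | p (num y)]|.
Proof.
have -> : iota 0 n = [seq num y | y <- Defs.order A].
  apply: (@eq_from_nth _ 0); rewrite size_iota ?size_map // => i lt_i.
  have [x def_i] := num_onto lt_i.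
  rewrite nth_iota // (nth_map x) // {2}def_i nth_index ?order_mem //.
rewrite count_map -size_filter -(card_uniqP _).
  by apply: eq_card => y; rewrite !inE mem_filter order_mem andbT.
by rewrite filter_uniq // order_uniq.
Qed.

Lemma offsets_le v : v <= n -> nth 0 (offsets A) v <= 2 * #|edges G|.
Proof.
move=> v_n; apply: leq_trans (handshake_leq G).
have card_nbrs (x : G) : #|[pred y | adj x y]| = size (nbrs A x).
  rewrite -(card_uniqP (nbrs_uniq A x)).
  by apply: eq_card => y; rewrite !inE nbrs_mem.
rewrite nth_offsets // shape_lists.
have -> : \sum_(x : G) #|[pred y | adj x y]| =
    sumn [seq size (nbrs A x) | x <- Defs.order A].
  rewrite sumnE big_map (big_uniq _ (order_uniq A)) /=.
  by apply: eq_big => [x|x _]; rewrite ?order_mem.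
by rewrite -[X in _ <= sumn X](cat_take_drop v) sumn_cat leq_addr.
Qed.

Lemma size_order : n = #|G|.
Proof.
rewrite /n -(card_uniqP (order_uniq A)).
by apply: eq_card => x; rewrite order_mem.
Qed.

(* A vertex x is adjacent to the rest of its class iff the number of its
   neighbors of its own color is one less than the size of the class. *)
Lemma checkP (c : nat -> bool) :
  reflect (clique_split (fun x : G => c (num x))) (all (check L n c) (iota 0 n)).
Proof.
have sameE x : ((count (fun w => c w == c (num x)) (L (num x))).+1
      == count (fun u => c u == c (num x)) (iota 0 n))
    = [forall y, (y != x) && (c (num y) == c (num x)) ==> adj x y].
  rewrite count_lists count_order.
  set N := [set y | _ & _]; set S := [set y | _].
  have xS : x \in S by rewrite inE.
  have NS : N \subset S :\ x.
    apply/subsetP=> y; rewrite !inE => /andP[xy ->]; rewrite andbT.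
    by apply: contraTneq xy => ->; rewrite adj_irr.
  (* Since [N] lies in [S :\ x], equal cardinalities mean equal sets. *)
  rewrite (cardsD1 x S) xS add1n eqSS (subset_leqif_cards NS) eqEsubset NS /=.
  apply/subsetP/forallP => [SN y|SN y].
    apply/implyP=> /andP[yx cy]; have := SN y.
    by rewrite !inE yx cy => /(_ isT)/andP[].
  by rewrite !inE => /andP[yx cy]; have := SN y; rewrite yx cy /= => ->.
have crossE x : size (cross c (num x) (L (num x)))
    = #|[set y | adj x y & c (num y) != c (num x)]|.
  by rewrite size_filter count_lists.
apply: (iffP allP) => [ok|[cl cr] v].
  have okx x : check L n c (num x) by apply: ok; rewrite mem_iota num_lt.
  split=> [x y xy cxy|x].
    have /andP[] := okx x; rewrite sameE => /forallP/(_ y).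
    by rewrite eq_sym xy cxy eqxx.
  by have /andP[_] := okx x; rewrite crossE.
rewrite mem_iota => /num_onto[x ->]; rewrite /check sameE crossE cr andbT.
apply/forallP=> y; apply/implyP=> /andP[yx /eqP cy].
by apply: cl => //; rewrite eq_sym.
Qed.

Lemma seed_color_complete (c : G -> bool) :
  clique_split c ->
  exists b : 5.-tuple bool, accepts n L b.
Proof.
pose f (c : G -> bool) i := nth false [seq c y | y <- Defs.order A] i.
have fE c' x : f c' (num x) = c' x.
  by rewrite /f (nth_map x) ?num_lt // nth_index // order_mem.
(* After swapping the colors if necessary, at least three of the first five vertices are [true].
   With fewer than five vertices nothing is assumed, since all of them are seeds. *)
wlog major : c / 5 <= n -> 2 < count (f c) (iota 0 5) => [thm split_c|].
  case: (ltnP n 5) => [|ge5]; first by move=> lt5; apply: (thm c) => // ge5; lia.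
  case: (ltnP 2 (count (f c) (iota 0 5))) => maj; first exact: (thm c).
  apply: (thm (fun x => ~~ c x)); last exact: clique_split_neg.
  move=> _; have -> : count (f (fun x => ~~ c x)) (iota 0 5)
      = count (predC (f c)) (iota 0 5).
    apply: eq_in_count => i; rewrite mem_iota => /andP[_ lt_i].
    have [|x ->] := @num_onto i; first exact: leq_trans ge5.
    by rewrite /= !fE.
  by have := count_predC (f c) (iota 0 5); rewrite size_iota; lia.
move=> split_c; have [cl cr] := split_c.
pose b : 5.-tuple bool := Tuple (introT eqP (size_mkseq (f c) 5)).
have bE i : i < 5 -> nth false b i = f c i by move=> lt_i; rewrite nth_mkseq.
have colE x : seed_color L b (num x) = c x.
  rewrite /seed_color; case: ltnP => [lt5|ge5]; first by rewrite bE ?fE.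
  have -> : count (fun w => (w < 5) && nth false b w) (L (num x))
      = count (fun w => (w < 5) && f c w) (L (num x)).
    by apply: eq_count => w; case: ltnP => // /bE ->.
  (* If [c x], the at least three seeds colored [true] are all neighbors of [x], its class being a
     clique. Otherwise the counted seeds are cross neighbors of [x], of which there are at most
     two. *)
  case cx: (c x).
    apply: leq_trans (major _) _; first exact: leq_trans ge5 (ltnW (num_lt x)).
    rewrite -!size_filter; apply: uniq_leq_size.
      by rewrite filter_uniq // iota_uniq.
    move=> w; rewrite !mem_filter mem_iota => /andP[fw /andP[_ w5]].
    rewrite w5 fw /=.
    have [|y def_w] := @num_onto w.
      exact: leq_trans (leq_trans w5 ge5) (ltnW (num_lt x)).
    rewrite def_w mem_lists; apply: cl; last by rewrite cx -fE -def_w fw.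
    by apply: contraTneq w5 => xy; rewrite def_w -xy -leqNgt.
  apply/negbTE; rewrite -leqNgt count_lists.
  apply: leq_trans (cr x); apply: subset_leq_card; apply/subsetP=> y.
  by rewrite !inE fE cx => /andP[-> /andP[_ ->]].
exists b; apply/checkP; split=> [x y|x]; first by rewrite !colE; exact: cl.
by have := cr x; congr (_ <= 2); apply: eq_card => y; rewrite !inE !colE.
Qed.

Lemma output_realizes (c : nat -> bool) (s : state) :
  all (check L n c) (iota 0 n) -> output_written n L c s ->
  exists (H : sgraph) (phi : edge H -> 'I_2),
    [/\ proper_coloring phi, giso G (CL phi) & output_encodes s phi].
Proof.
move=> ok [_ s1 s2 out]; have [cliques _] := checkP c ok.
pose X v := cross c v (L v).
have mem_X x y : (num y \in X (num x)) = adj x y && (c (num x) != c (num y)).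
  by rewrite mem_filter mem_lists andbC eq_sym.
have X_uniq v : v < n -> uniq (X v).
  move=> /num_onto[x ->]; rewrite filter_uniq // lists_num.
  by rewrite (map_inj_uniq num_inj) nbrs_uniq.
have X_size v : v < n -> size (X v) <= 2.
  by move=> v_n; have /allP/(_ v) := ok; rewrite mem_iota => /(_ v_n)/andP[].
have X_sym v w : v < n -> w \in X v -> [/\ w < n, w != v & v \in X w].
  move=> v_n wX; have w_n : w < n.
    by move: wX; rewrite mem_filter => /andP[_ /(lists_lt v_n)].
  move: v_n w_n wX => /num_onto[x ->] /num_onto[y ->]; rewrite !mem_X => xy.
  split; [exact: num_lt| |by rewrite adj_sym eq_sym].
  by apply: contraTneq xy => ->; rewrite eqxx andbF.
have lt0 x : out_end1 s (num x) < out_nv s.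
  have [e _ _] := out _ (num_lt x).
  by rewrite /out_end1 /out_nv e s1; apply: end_of_lt => //; exact: num_lt.
have lt1 x : out_end2 s (num x) < out_nv s.
  have [_ e _] := out _ (num_lt x).
  by rewrite /out_end2 /out_nv e s1; apply: end_of_lt => //; exact: num_lt.
pose e0 x := Ordinal (lt0 x); pose e1 x := Ordinal (lt1 x).
have e0E x : e0 x = end_of X (num x) 0 :> nat by have [] := out _ (num_lt x).
have e1E x : e1 x = end_of X (num x) 1 :> nat by have [] := out _ (num_lt x).
pose ends x := [set e0 x; e1 x].
have endsP x (a : 'I_(out_nv s)) :
    reflect (exists2 k, k < 2 & a = end_of X (num x) k :> nat) (a \in ends x).
  rewrite !inE; apply: (iffP orP) => [[/eqP->|/eqP->]|[[|[|k]]] // _ aE].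
  - by exists 0.
  - by exists 1.
  - by left; rewrite -val_eqE /= aE -e0E.
  - by right; rewrite -val_eqE /= aE -e1E.
have inj x y k k' : k < 2 -> k' < 2 ->
    end_of X (num x) k = end_of X (num y) k' ->
    x = y /\ k = k' \/ [/\ x != y, nth (num x) (X (num x)) k = num y &
                          nth (num y) (X (num y)) k' = num x].
  move=> k2 k'2 /(end_of_inj X_uniq X_size X_sym (num_lt x) (num_lt y) k2 k'2).
  case=> [[/num_inj xy kk']|[xy h1 h2]]; [by left|right].
  by split=> //; apply/eqP=> xy'; apply: xy; rewrite xy'.
(* If distinct [x] and [y] had the same ends, both entries of the list of [x] would be [num y], but
   its entries are distinct. *)
have ends_inj : injective ends.
  move=> x y exy; apply/eqP; apply: contraT => xy.
  have shared k : k < 2 -> nth (num x) (X (num x)) k = num y.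
    move=> k2; pose a := if k == 0 then e0 x else e1 x.
    have aE : a = end_of X (num x) k :> nat.
      rewrite /a {a}; case: k k2 => [|[|k]] // _; [exact: e0E|exact: e1E].
    have: a \in ends y by rewrite -exy; apply/endsP; exists k.
    case/endsP=> k' k'2; rewrite aE => /(inj _ _ _ _ k2 k'2) [[xy' _]|[] //].
    by rewrite xy' eqxx in xy.
  have ny k : k < 2 -> k < size (X (num x)).
    move=> k2; have [|//] := @nth_cross X (num x) k.
    by rewrite shared // => /num_inj xy'; rewrite xy' eqxx in xy.
  have /eqP := etrans (shared 0 isT) (esym (shared 1 isT)).
  by rewrite nth_uniq ?ny // X_uniq // num_lt.
(* By [inj] a common end makes [x] and [y] cross neighbors; conversely [end_of_share] provides a
   common end. *)
have shareE x y : x != y ->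
    (ends x :&: ends y != set0) = adj x y && (c (num x) != c (num y)).
  move=> xy; rewrite -mem_X; apply/set0Pn/idP=> [[a]|yX].
    rewrite inE => /andP[/endsP[k k2 aE] /endsP[k' k'2]].
    rewrite aE => /(inj _ _ _ _ k2 k'2).
    case=> [[xy' _]|[_ yE _]]; first by rewrite xy' eqxx in xy.
    have [|_] := @nth_cross X (num x) k; last by rewrite yE.
    by rewrite yE => /num_inj xy'; rewrite xy' eqxx in xy.
  have [k [k' [k2 k'2 ek]]] := end_of_share X_size X_sym (num_lt x) yX.
  have lt_k : end_of X (num x) k < out_nv s.
    by rewrite /out_nv s1; apply: end_of_lt => //; exact: num_lt.
  exists (Ordinal lt_k); rewrite inE; apply/andP; split; apply/endsP.
    by exists k.
  by exists k'.
have e01 x : e0 x != e1 x.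
  apply/eqP=> /(congr1 (@nat_of_ord _)); rewrite e0E e1E.
  by case/(inj x x 0 1 isT isT)=> [[]|[]]; rewrite ?eqxx.
have [H [phi [phi_proper iso [vx [ed [vx_bij ed_bij edE]]]]]] :=
  ends_realize cliques e01 ends_inj shareE.
exists H, phi; split=> //.
have lt_ne (i : 'I_(out_ne s)) : i < size (Defs.order A).
  by rewrite -[X in _ < X]s2; exact: ltn_ord.
pose vert i : G := tnth (in_tuple (Defs.order A)) (Ordinal (lt_ne i)).
have vertK i : num (vert i) = i.
  by rewrite /vert (tnth_nth (vert i)) /num index_uniq ?order_uniq.
have num_ne x : num x < out_ne s by rewrite /out_ne s2; exact: num_lt.
exists vx, (ed \o vert); split=> //.
  apply: bij_comp ed_bij _; exists (fun x => Ordinal (num_ne x)) => [i|x].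
    by apply: val_inj; exact: vertK.
  by apply: num_inj; rewrite vertK.
move=> i; have [col endsE] := edE (vert i).
have [_ _ colE] := out _ (num_lt (vert i)).
split; first by rewrite /= col -colE vertK.
by exists (e0 (vert i)), (e1 (vert i)); rewrite /= vertK.
Qed.

End AdjacencyLists.

Theorem theorem10 :
  exists (p : cmd) (c : nat),
    forall (G : sgraph) (A : adj_lists G),
      exists (t : nat) (s : state),
        [/\ exec (c * (graph_size G).+1) p (input_state A) t s,
            t <= c * (graph_size G).+1,
            answer s <> 0 <-> proper_2_color_line G &
            proper_2_color_line G ->
              exists (H : sgraph) (phi : edge H -> 'I_2),
                [/\ proper_coloring phi, giso G (CL phi) &
                    output_encodes s phi]].
Proof.
(* The factor 2 absorbs the two list entries per edge: [n + 2e + 1 <= 2 * (n + e + 1)]. The same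
   number serves as time bound and as largest word. *)
exists recognizer, (2 * (33 * 1003 + 203)) => G A.
set W := _ * _; pose n := size (Defs.order A); pose M := 2 * #|edges G|.
have size_le : (33 * 1003 + 203) * (n + M + 1) <= W.
  by rewrite /W /graph_size /M -(size_order A) -/n; lia.
have [] := @recognizer_runs n M W (nth 0 (offsets A)) (nth 0 (targets A))
  (nth [::] (lists A)) _ _ _ _ _ _ (input_state A) _ _ => //.
- by rewrite nth_offsets ?take0.
- exact: offsets_next.
- exact: offsets_le.
- exact: nth_targets.
- exact: lists_lt.
(* The word size leaves room for list positions up to [M], vertex numbers of H below [n + n] and the
   constants of the program. *)
- by lia.
move=> t [s [E le_t post]]; exists t, s; split=> //.
  exact: leq_trans size_le.
  (* A nonzero answer comes with an output that realizes G; conversely, a split of G yields an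
     accepting seed, which excludes the answer 0. *)
  split=> [ok|/CL_clique_split[c /(seed_color_complete A)[b ab]]].
    case: post => [[b ab out]|[s0 _]]; last by [].
    have [H [phi [phi_proper iso _]]] := output_realizes ab out.
    by exists H, phi.
  case: post => [[b' _ [s0 _ _ _]]|[_ /(_ b)]]; last by rewrite ab.
  by rewrite /answer s0.
case/CL_clique_split=> c /(seed_color_complete A)[b ab].
case: post => [[b' ab' out]|[_ /(_ b)]]; last by rewrite ab.
exact: output_realizes ab' out.
Qed.
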